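(* Assume $cov(\mathcal{M})<\mathfrak{b}$. Then $cov(\mathcal{M})$ is the minimum $\pi$-weight of a weakly Lindelöf space which is not weakly Rothberger.
   Context: $cov(\mathcal{M})$ is the least cardinality of a family of meager subsets of the real line covering the real line. $\mathfrak{b}$ is the least cardinality of a subset of $\omega^\omega$ that is unbounded with respect to eventual domination $\le^*$. A $\pi$-base for a space $X$ is a family $\mathcal{P}$ of non-empty open sets such that every non-empty open $U\subset X$ contains some $P\in\mathcal{P}$; the $\pi$-weight of $X$ is the minimum cardinality of a $\pi$-base. A space is weakly Lindelöf if every open cover has a countable subcollection with dense union. $X$ is weakly Rothberger if for every sequence $(\mathcal{U}_n)_{n<\omega}$ of open covers of $X$ one can choose $U_n\in\mathcal{U}_n$ for each $n<\omega$ such that $\bigcup_{n<\omega}U_n$ is dense in $X$. *)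

(* Defs.v *)
From HB Require Import structures.
From mathcomp Require Import all_boot all_order all_algebra.
From mathcomp Require Import all_classical all_reals all_analysis.
Import numFieldNormedType.Exports.

Local Open Scope classical_set_scope.
Local Open Scope card_scope.

(* Cardinal numbers are represented by sets up to equipotence: a cardinal
   invariant denotes a set having the required cardinality. *)

Definition card_lt {T U : Type} (A : set T) (B : set U) : Prop :=
  A #<= B /\ ~ (B #<= A).

(* A member of the family P whose cardinality is least among the members of P;
   it exists as soon as P is non-empty, see [least_cardP]. *)
Definition least_card {T : Type} (P : set (set T)) : set T :=
  xget set0 [set A | P A /\ forall B, P B -> A #<= B].

Lemma least_card_ex {T : Type} (P : set (set T)) :
  P !=set0 -> exists A, P A /\ forall B, P B -> A #<= B.
Proof.
have [P0 _|nP0] := pselect (P set0).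
  by exists set0; split => // B _; exact: card_ge0.
move=> [A0 PA0].
have ne A : P A -> A !=set0.
  by move=> PA; apply/set0P/eqP => A_0; apply: nP0; rewrite -A_0.
pose ok (S : set (set T -> T)) :=
  (forall f A, S f -> P A -> A (f A)) /\
  (forall f g A, S f -> S g -> P A -> f A = g A -> f = g).
have [F subF totF|S [okS maxS]] := @Zorn_bigcup _ ok.
  split=> [f A [S FS Sf] PA|f g A [S FS Sf] [S' FS' S'g] PA].
    by have [h _] := subF S FS; exact: (h f A).
  have [SS'|S'S] := totF _ _ FS FS'.
    by have [_ h] := subF S' FS'; apply: (h f g A) => //; exact: SS'.
  by have [_ h] := subF S FS; apply: (h f g A) => //; exact: S'S.
have [okS1 okS2] := okS.
have [[A PA AS]|noA] :=
    pselect (exists2 A, P A & A `<=` (fun f : set T -> T => f A) @` S).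
  exists A; split=> // B PB.
  apply: (card_le_trans (subset_card_le AS)).
  apply: (card_le_trans (card_image_le _ _)).
  have injB : {in S &, injective (fun f : set T -> T => f B)}.
    by move=> f g /set_mem Sf /set_mem Sg /= fg; exact: (okS2 f g B).
  apply: (@card_le_trans _ _ _ ((fun f : set T -> T => f B) @` S)).
    by have /card_esym := inj_card_eq injB; rewrite card_eq_le => /andP[].
  by apply: subset_card_le => _ [f Sf <-]; exact: (okS1 f B).
have [x0 _] := ne _ PA0.
have hex (A : set T) : exists x,
    P A -> A x /\ forall f, S f -> f A <> x.
  have [PA|nPA] := pselect (P A); last by exists x0.
  apply: contrapT => nx; apply: noA; exists A => // x Ax.
  apply: contrapT => nSx; apply: nx; exists x => _; split=> // f Sf fA.
  by apply: nSx; exists f.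
have [h hP] := choice hex.
exfalso; apply: (maxS (S `|` [set h])); last first.
  split=> [f A [Sf|->] PA|f g A [Sf|->] [Sg|->] PA].
  - exact: (okS1 f A).
  - by have [] := hP A PA.
  - exact: (okS2 f g A).
  - by move=> e; have [_ /(_ f Sf)] := hP A PA.
  - by move=> e; have [_ /(_ g Sg)] := hP A PA; rewrite e.
  - by [].
split; first exact: subsetUl.
move=> /(_ h (or_intror erefl)) Sh.
by have [_ /(_ h Sh)] := hP A0 PA0.
Qed.

Lemma least_cardP {T : Type} (P : set (set T)) : P !=set0 ->
  P (least_card P) /\ forall B, P B -> least_card P #<= B.
Proof. by move=> /least_card_ex; exact: xgetPex. Qed.

Definition nowhere_dense {X : topologicalType} (A : set X) : Prop :=
  interior (closure A) = set0.

Definition meager {X : topologicalType} (A : set X) : Prop :=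
  exists2 N : nat -> set X,
    forall n, nowhere_dense (N n) & A = \bigcup_n N n.

Definition meager_cover (R : realType) : set (set (set R)) :=
  [set F | (forall A, F A -> meager A) /\ \bigcup_(A in F) A = setT].

Definition cov_meager (R : realType) : set (set R) :=
  least_card (@meager_cover R).

Lemma meager_cover_nonempty (R : realType) : @meager_cover R !=set0.
Proof.
exists [set [set x] | x in setT]; split=> [_ [x _ <-]|]; last first.
  by apply/seteqP; split=> // x _; exists [set x] => //; exists x.
exists (fun=> [set x]) => [_|]; last by rewrite bigcup_const //; exists 0%N.
rewrite /nowhere_dense -(closure_id _).1; last by apply: accessible_closed_set1; apply: hausdorff_accessible; exact: Rhausdorff.
by rewrite interior_set1.
Qed.

Definition eventually_le (f g : nat -> nat) : Prop :=
  \forall n \near \oo, (f n <= g n)%N.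

Definition unbounded_family : set (set (nat -> nat)) :=
  [set B | ~ exists g, forall f, B f -> eventually_le f g].

Definition bounding_number : set (nat -> nat) := least_card unbounded_family.

Lemma unbounded_family_nonempty : unbounded_family !=set0.
Proof.
exists setT => -[g] /(_ (fun n => (g n).+1) I) [n _ /(_ n (leqnn n))] /=.
by rewrite ltnn.
Qed.

Definition pi_base {X : topologicalType} : set (set (set X)) :=
  [set P | (forall A, P A -> open A /\ A !=set0) /\
    forall U, open U -> U !=set0 -> exists2 A, P A & A `<=` U].

Definition pi_weight (X : topologicalType) : set (set X) :=
  least_card (@pi_base X).

Lemma pi_base_nonempty (X : topologicalType) : @pi_base X !=set0.
Proof.
exists [set U | open U /\ U !=set0]; split=> // U oU U0.
by exists U.
Qed.

Definition open_cover {X : topologicalType} (U : set (set X)) : Prop :=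
  (forall A, U A -> open A) /\ \bigcup_(A in U) A = setT.

Definition weakly_lindelof (X : topologicalType) : Prop :=
  forall U : set (set X), open_cover U ->
    exists V : set (set X),
      [/\ V `<=` U, countable V & dense (\bigcup_(A in V) A)].

(* The empty family is an open cover of the empty space, from which nothing can
   be chosen: under this definition the empty space is not weakly Rothberger.
   Spaces are to be assumed non-empty. *)
Definition weakly_rothberger (X : topologicalType) : Prop :=
  forall U : nat -> set (set X), (forall n, open_cover (U n)) ->
    exists2 A : nat -> set X,
      forall n, U n (A n) & dense (\bigcup_n A n).

(* Main.v *)
(* Lower bound: let P be a pi-base with fewer than cov(M) members, and thin each
   cover U_n to a countable family V_n0, V_n1, ... with dense union.  Reading
   off from a real x a sequence of naturals (n-th entry taken on the n-th basic
   interval, where every value occurs on an open set), the reals whose selection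
   misses a given A in P form a nowhere dense set, so some real gives a selection
   meeting every A in P.

   Upper bound: let M be a meager cover of size cov(M).  A sequence f of naturals
   encodes a descent through a countable pi-base of compact sets, hence a real
   x_f.  As |M| < b, one function bounds, for all A in M and almost all n, the
   code of an instruction that takes every position reachable at stage n into a
   set disjoint from the first n nowhere dense pieces of A.  Let g_A list these
   instructions; if f equals g_A infinitely often, x_f is not in A, so every f is
   eventually different from some g_A.  The space has an isolated point and a
   non-isolated one for each A, neighbourhoods of the latter being given by the
   initial segments of g_A.  It is Lindelof because these segments are
   countably many, and the covers by the value of the n-th coordinate show that
   it is not weakly Rothberger. *)
Require Import Defs.
From HB Require Import structures.
From mathcomp Require Import all_boot all_order all_algebra.
From mathcomp Require Import all_classical all_reals all_analysis.
Import numFieldNormedType.Exports.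
Local Open Scope classical_set_scope.
Local Open Scope card_scope.

Set Implicit Arguments.
Unset Strict Implicit.
Unset Printing Implicit Defensive.

Import Order.TTheory GRing.Theory Num.Theory.

Definition pi_enumeration {X : topologicalType} (C : nat -> set X) : Prop :=
  [/\ forall k, compact (C k), forall k, interior (C k) !=set0 &
      forall U, open U -> U !=set0 -> exists k, C k `<=` U].

Lemma real_pi_enumeration (R : realType) :
  exists C : nat -> set R, pi_enumeration C.
Proof.
pose seg (o : option (rat * rat)) : set R :=
  if o is Some (a, b) then
    if (a < b)%R then `[ratr a, ratr b]%classic else `[0%R, 1%R]%classic
  else `[0%R, 1%R]%classic.
have segE o : exists a b : R, (a < b)%R /\ seg o = `[a, b]%classic.
  rewrite /seg; case: o => [[a b]|]; last by exists 0%R, 1%R.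
  have [ab|_] := boolP (a < b)%R; last by exists 0%R, 1%R.
  by exists (ratr a), (ratr b); rewrite ltr_rat.
exists (fun k => seg (unpickle k)); split=> [k|k|U oU [x Ux]].
- by have [a [b [_ ->]]] := segE (unpickle k); exact: segment_compact.
- have [a [b [ab ->]]] := segE (unpickle k).
  rewrite interior_itv_bnd; exists ((a + b) / 2)%R => /=.
  by rewrite in_itv /= !midf_lt.
- have /nbhs_ballP[e /= e0 xeU] : nbhs x U by exact: open_nbhs_nbhs.
  have xe : (x < x + e)%R by rewrite ltrDl.
  have [a] := rat_in_itvoo xe; rewrite in_itv /= => /andP[xa ae].
  have [b] := rat_in_itvoo ae; rewrite in_itv /= => /andP[ab be].
  exists (pickle (a, b)) => y; rewrite pickleK /seg -(ltr_rat R) ab /=.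
  rewrite in_itv /= => /andP[ay yb]; apply: xeU.
  rewrite /ball /= ltr_distlC (lt_le_trans _ ay) ?(le_lt_trans yb)//.
  by rewrite (lt_trans _ xa)// ltrBlDr.
Qed.

Lemma open_splits_nat (R : realType) (U : set R) : open U -> U !=set0 ->
  exists phi : R -> nat, forall k, exists V : set R,
    [/\ open V, V !=set0, V `<=` U & forall x, V x -> phi x = k].
Proof.
move=> oU [x0 Ux0].
have /nbhs_ballP[e /= e0 xeU] : nbhs x0 U by exact: open_nbhs_nbhs.
pose K := (Num.truncn e^-1%R).+1.
exists (fun x => (Num.truncn (x - x0)^-1%R - K)%N) => k.
pose c (m : nat) : R := ((K + m)%:R^-1)%R.
have c0 m : (0 < c m)%R by rewrite invr_gt0 ltr0n.
have cS m : (c m.+1 < c m)%R.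
  by rewrite ltf_pV2 ?posrE ?ltr0n ?addnS// ltr_nat.
have ce m : (c m < e)%R.
  rewrite -[ltRHS]invrK ltf_pV2 ?posrE ?ltr0n ?invr_gt0//.
  apply: (lt_le_trans (truncnS_gt _)); by rewrite ler_nat leq_addr.
exists `](x0 + c k.+1)%R, (x0 + c k)%R[%classic; split.
- exact: interval_open.
- exists (((x0 + c k.+1) + (x0 + c k)) / 2)%R => /=.
  by rewrite in_itv /= !midf_lt// ltrD2l.
- move=> x /=; rewrite in_itv /= => /andP[x1 x2]; apply: xeU.
  rewrite /ball /= ltr_distlC; apply/andP; split.
    by rewrite (lt_trans _ x1)// ltrD2l (lt_trans _ (c0 _))// oppr_lt0.
  by rewrite (lt_trans x2)// ltrD2l.
- move=> x /=; rewrite in_itv /= -ltrBrDl -(ltrBlDl x) => /andP[x1 x2].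
  have xp : (0 < x - x0)%R by rewrite (lt_trans _ x1).
  suff /eqP -> : Num.truncn (x - x0)^-1%R == (K + k)%N by rewrite addKn.
  rewrite truncn_eq; last by rewrite invr_ge0 ltW.
  apply/andP; split.
    by rewrite ltW// -[ltLHS]invrK ltf_pV2 ?posrE ?invr_gt0 ?ltr0n.
  by rewrite -[ltRHS]invrK ltf_pV2 ?posrE ?invr_gt0 ?ltr0n// -addnS.
Qed.

Lemma nowhere_dense_avoid_open {X : topologicalType} (A : set X) (O : set X) :
  open O -> dense O -> A `&` O `<=` set0 -> nowhere_dense A.
Proof.
move=> oO dO AO; apply: contrapT => /eqP/set0P ne.
have [x [Ax Ox]] := dO _ ne (@open_interior _ _).
by have [y /AO] := interior_subset Ax _ (open_nbhs_nbhs (conj oO Ox)).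
Qed.

Lemma countable_range {T : Type} (V : set T) :
  countable V -> V !=set0 -> exists v : nat -> T, V = range v.
Proof.
move=> /pfcard_geP[->|[v]] [x Vx] //.
by exists v; apply/seteqP; split=> [y /(@surj _ _ _ _ v)[n _ <-]|_ [n _ <-]];
  [exists n|exact: funS].
Qed.

Lemma meager_cover_le_pi_base (R : realType) (X : topologicalType)
    (P : set (set X)) :
  [set: X] !=set0 -> weakly_lindelof X -> ~ weakly_rothberger X ->
  pi_base P -> cov_meager R #<= P.
Proof.
move=> X0 wL nwR [Popen Pbase].
apply: contrapT => nle; apply: nwR => U Ucov.
have /choice[V hV] n : exists v : nat -> set X,
    (forall k, U n (v k)) /\ dense (\bigcup_k v k).
  have [V [VU cV dV]] := wL _ (Ucov n).
  have V0 : V !=set0.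
    by have [x [_ [A VA _]]] := dV _ X0 openT; exists A.
  have [v vV] := countable_range cV V0.
  exists v; split=> [k|]; first by apply: VU; rewrite vV; exists k.
  by rewrite vV bigcup_image in dV.
have [C [_ Cint Cbase]] := real_pi_enumeration R.
have /choice[phi hphi] m := open_splits_nat (@open_interior _ (C m)) (Cint m).
pose miss (A : set X) : set R := [set x | forall m, V m (phi m x) `&` A = set0].
have missM A : P A -> meager (miss A).
  move=> /Popen[oA A0]; exists (fun=> miss A); last by rewrite bigcup_const//; exists 0%N.
  move=> _.
  have /choice[W hW] m : exists W : set R,
      [/\ open W, W !=set0, W `<=` C m & forall x, W x -> V m (phi m x) `&` A !=set0].
    have [_ dV] := hV m; have [x [Ax [k _ Vx]]] := dV _ A0 oA.
    have [W [oW W0 WC Wk]] := hphi m k; exists W; split=> //.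
      exact: (subset_trans WC (@interior_subset _ _)).
    by move=> y /Wk ->; exists x.
  apply: (@nowhere_dense_avoid_open _ _ (\bigcup_m W m)).
  - by apply: bigcup_open => m _; have [] := hW m.
  - move=> O O0 oO; have [m CO] := Cbase _ oO O0.
    have [_ [x Wx] WC _] := hW m.
    by exists x; split; [exact/CO/WC|exists m].
  - move=> x [missx [m _ Wx]]; have [_ _ _ /(_ x Wx)] := hW m.
    by rewrite missx => -[].
have [x hx] : exists x, forall A, P A -> ~ miss A x.
  apply: contrapT => nx; apply: nle.
  have [_ covmin] := least_cardP _ (meager_cover_nonempty R).
  apply: (card_le_trans _ (card_image_le miss P)); apply: covmin; split.
    by move=> _ [A PA <-]; exact: missM.
  apply/seteqP; split=> // x _; apply: contrapT => nM; apply: nx; exists x => A PA mA.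
  by apply: nM; exists (miss A) => //; exists A.
exists (fun n => V n (phi n x)) => [n|]; first by have [] := hV n.
move=> O O0 oO; have [A PA AO] := Pbase _ oO O0.
have /existsNP[n /eqP/set0P[y [Vy Ay]]] := hx _ PA.
by exists y; split; [exact: AO|exists n].
Qed.

Lemma avoid_nowhere_dense {X : topologicalType} (C : nat -> set X)
    (N : nat -> set X) (p m : nat) :
  pi_enumeration C -> (forall n, nowhere_dense (N n)) ->
  exists k, C k `<=` C p /\ forall j, (j <= m)%N -> C k `&` N j = set0.
Proof.
move=> [_ Cint Cbase] Nnd.
have step q n : exists k, C k `<=` C q /\ C k `&` N n = set0.
  have [k CU] : exists k, C k `<=` interior (C q) `&` ~` closure (N n).
    apply: Cbase.
      by apply: openI; [exact: open_interior|exact/closed_openC/closed_closure].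
    apply/set0P/eqP => I0; have [x Cx] := Cint q.
    suff : interior (closure (N n)) x by rewrite Nnd.
    apply: filterS (open_nbhs_nbhs (conj (@open_interior _ (C q)) Cx)) => y Cy.
    apply: contrapT => Ny.
    by have : set0 y by rewrite -I0.
  exists k; split=> [x /CU[/interior_subset]//|].
  by apply/seteqP; split=> // x [/CU[_ nN] /subset_closure].
elim: m => [|m [k [kp kN]]].
  have [k [kp kN]] := step p 0%N; exists k; split=> // j.
  by rewrite leqn0 => /eqP ->.
have [l [lk lN]] := step k m.+1; exists l; split; first exact: subset_trans kp.
move=> j; rewrite leq_eqVlt => /predU1P[->//|/kN kj].
exact: (subsetI_eq0 lk _ kj).
Qed.

Lemma nested_compact_point {X : topologicalType} (C : nat -> set X) :
  hausdorff_space X -> (forall n, compact (C n)) -> (forall n, C n !=set0) ->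
  (forall n, C n.+1 `<=` C n) -> exists x, forall n, C n x.
Proof.
move=> hX cC C0 CS.
have /choice[u Cu] := C0.
have Cle m n : (m <= n)%N -> C n `<=` C m.
  by move=> /subnK <-; elim: (n - m)%N => // k; apply: subset_trans; rewrite addSn.
have [x [_ clx]] : C 0%N `&` cluster (u @ \oo) !=set0.
  by apply: cC; exists 0%N => // n _ /=; apply: (Cle 0%N n) => //; exact: Cu.
exists x => n; have /closure_id -> : closed (C n) by exact: compact_closed.
move=> B xB; apply: clx => //.
by exists n => // m /= nm; apply: (Cle n m).
Qed.

(* Reading l as the code of a list of instructions, one for each position p: move
   from p to the prescribed k, provided that shrinks C p, and stay at p otherwise. *)
Definition steer {X : Type} (C : nat -> set X) (p l : nat) : nat :=
  let k := nth 0%N (CodeSeq.decode l) p in if `[< C k `<=` C p >] then k else p.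

Fixpoint steered {X : Type} (C : nat -> set X) (f : nat -> nat) (n : nat) : nat :=
  if n is m.+1 then steer C (steered C f m) (f m) else 0%N.

Lemma steer_sub {X : Type} (C : nat -> set X) p l : C (steer C p l) `<=` C p.
Proof. by rewrite /steer; case: asboolP => // _; exact: subset_refl. Qed.

Lemma steer_avoid {X : topologicalType} (C : nat -> set X)
    (N : nat -> set X) (m : nat) :
  pi_enumeration C -> (forall n, nowhere_dense (N n)) ->
  exists l, forall p j, (p <= m)%N -> (j <= m)%N -> C (steer C p l) `&` N j = set0.
Proof.
move=> eC Nnd.
have /choice[k hk] p := avoid_nowhere_dense p m eC Nnd.
exists (CodeSeq.code (mkseq k m.+1)) => p j pm jm.
rewrite /steer CodeSeq.codeK nth_mkseq// asboolT; last by have [] := hk p.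
by have [_ ->] := hk p.
Qed.

Lemma steered_point {X : topologicalType} (C : nat -> set X) f :
  hausdorff_space X -> pi_enumeration C -> exists x, forall n, C (steered C f n) x.
Proof.
move=> hX [cC Cint _]; apply: (@nested_compact_point _ (C \o steered C f)) => //= n.
- by have [x /interior_subset Cx] := Cint (steered C f n); exists x.
- exact: steer_sub.
Qed.

Lemma steered_bound {X : Type} (C : nat -> set X) (h : nat -> nat) :
  exists b : nat -> nat, (forall n, (n <= b n)%N) /\
    forall f, (forall n, (f n <= h (b n))%N) -> forall n, (steered C f n <= b n)%N.
Proof.
have /choice[beta hbeta] m : exists M, (m < M)%N /\
    forall p l, (p <= m)%N -> (l <= h m)%N -> (steer C p l <= M)%N.
  exists (m.+1 + \sum_(p < m.+1) \sum_(l < (h m).+1) steer C p l)%N.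
  split=> [|p l pm lm]; first exact: leq_addr.
  rewrite (bigD1 (Ordinal (pm : (p < m.+1)%N)))//=.
  rewrite (bigD1 (Ordinal (lm : (l < (h m).+1)%N)))//=.
  by rewrite addnCA -!addnA leq_addr.
exists (fun n => iter n beta 0%N); split=> [n|f fh n].
  elim: n => // n IH; exact: (leq_ltn_trans IH (hbeta _).1).
by elim: n => // n IH; exact: (hbeta _).2.
Qed.

Lemma meager_eventually_different {X : topologicalType} (M : set (set X)) :
  hausdorff_space X -> (exists C : nat -> set X, pi_enumeration C) ->
  (forall A, M A -> meager A) -> \bigcup_(A in M) A = setT ->
  (forall e : set X -> nat -> nat, exists h, forall A, M A -> eventually_le (e A) h) ->
  exists g : set X -> nat -> nat, forall f, exists A, M A /\
    \forall n \near \oo, f n <> g A n.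
Proof.
move=> hX [C eC] Mm Mc dom.
have /choice[N hN] (A : set X) : exists N : nat -> set X, M A ->
    (forall n, nowhere_dense (N n)) /\ A = \bigcup_n N n.
  have [/Mm[N ? ?]|] := pselect (M A); first by exists N.
  by exists (fun=> set0).
have /choice[e he] (A : set X) : exists e : nat -> nat, M A ->
    forall m p j, (p <= m)%N -> (j <= m)%N -> C (steer C p (e m)) `&` N A j = set0.
  have [MA|] := pselect (M A); last by exists id.
  have /choice[e he] m := steer_avoid m eC (hN _ MA).1.
  by exists e.
have [h hh] := dom e.
have [b [nb hb]] := steered_bound C h.
exists (fun A n => minn (e A (b n)) (h (b n))) => f.
pose f' n := minn (f n) (h (b n)).
have f'b := hb f' (fun n => geq_minr _ _).
have [x hx] := steered_point f' hX eC.
have : (\bigcup_(A in M) A) x by rewrite Mc.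
move=> [A MA Ax]; exists A; split=> //.
have [Nnd AN] := hN _ MA.
rewrite AN in Ax; case: Ax => j _ Njx.
have [n0 _ hn0] := hh _ MA.
exists (maxn n0 j) => // n /=; rewrite geq_max => /andP[n0n jn] fg.
have eb : (e A (b n) <= h (b n))%N by apply: hn0; exact: leq_trans n0n (nb n).
have f'e : f' n = e A (b n) by rewrite /f' fg (minn_idPl eb) (minn_idPl eb).
have := he _ MA (b n) (steered C f' n) j (f'b n) (leq_trans jn (nb n)).
rewrite -f'e => /seteqP[/(_ x) + _]; apply; split=> //.
exact: (hx n.+1).
Qed.

(* A family eventually different from every f need not contain, for every f, a
   member that differs from f everywhere; but on one of countably many disjoint
   infinite blocks it does, or else the failures on the blocks would glue
   together. *)
Lemma eventually_to_everywhere_different {I : Type} (D : set I) (g : I -> nat -> nat) :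
  (forall f, exists i, D i /\ \forall n \near \oo, f n <> g i n) ->
  exists g' : I -> nat -> nat, forall f, exists i, D i /\ forall n, f n <> g' i n.
Proof.
move=> ev; pose c i j := CodeSeq.code [:: i; j].
have [[k hk]|nk] := pselect (exists k, forall f : nat -> nat,
    exists i, D i /\ forall n, f n <> g i (c k n)).
  by exists (fun i n => g i (c k n)).
exfalso.
have /choice[F hF] k : exists f : nat -> nat,
    forall i, D i -> exists n, f n = g i (c k n).
  apply: contrapT => nf; apply: nk; exists k => f.
  apply: contrapT => ni; apply: nf; exists f => i Di.
  by apply: contrapT => nn; apply: ni; exists i; split=> // n fg; apply: nn; exists n.
pose f n := let s := CodeSeq.decode n in F (nth 0%N s 0) (nth 0%N s 1).
have [i [Di [m _ hm]]] := ev f.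
have [n Fn] := hF m _ Di.
apply: (hm (c m n)); last by rewrite /f /c CodeSeq.codeK.
by have /and3P[/ltnW] := CodeSeq.ltn_code [:: m; n].
Qed.

(* (i, true) is isolated; (i, false) has as neighbourhoods all points (k, _) such
   that g k and g i have a given common initial segment.  This topology is not
   T0 when g is not injective, and never T1. *)
Definition twin {I : Type} (g : I -> nat -> nat) : Type := (I * bool)%type.

HB.instance Definition _ (I : Type) (g : I -> nat -> nat) := gen_eqMixin (twin g).
HB.instance Definition _ (I : Type) (g : I -> nat -> nat) := gen_choiceMixin (twin g).

Definition cylinder {I : Type} (g : I -> nat -> nat) (s : seq nat) : set (twin g) :=
  [set x | mkseq (g x.1) (size s) = s].

Definition twin_open {I : Type} (g : I -> nat -> nat) (U : set (twin g)) : Prop :=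
  forall i, U (i, false) -> exists n, cylinder (mkseq (g i) n) `<=` U.

Lemma twin_openT {I : Type} (g : I -> nat -> nat) : twin_open [set: twin g].
Proof. by move=> i _; exists 0%N. Qed.

Lemma twin_openI {I : Type} (g : I -> nat -> nat) (U V : set (twin g)) :
  twin_open U -> twin_open V -> twin_open (U `&` V).
Proof.
have sub i m n : (m <= n)%N ->
    @cylinder _ g (mkseq (g i) n) `<=` cylinder (mkseq (g i) m).
  move=> mn x; rewrite /cylinder /= !size_mkseq => e.
  by rewrite -(subnKC mn) /mkseq iotaD !map_cat in e; have /eqP := e;
    rewrite eqseq_cat ?size_map// => /andP[/eqP].
move=> oU oV i [Ui Vi]; have [m mU] := oU _ Ui; have [n nV] := oV _ Vi.
exists (maxn m n) => x cx; split.
- by apply: mU; apply: sub cx; exact: leq_maxl.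
- by apply: nV; apply: sub cx; exact: leq_maxr.
Qed.

Lemma twin_open_bigU {I : Type} (g : I -> nat -> nat) (J : Type) (U : J -> set (twin g)) :
  (forall j, twin_open (U j)) -> twin_open (\bigcup_j U j).
Proof.
move=> oU i [j _ /oU[n nU]]; exists n => x /nU Ux; by exists j.
Qed.

HB.instance Definition _ (I : Type) (g : I -> nat -> nat) :=
  isOpenTopological.Build (twin g) (@twin_openT I g) (@twin_openI I g) (@twin_open_bigU I g).

Lemma twin_openE {I : Type} (g : I -> nat -> nat) (U : set (twin g)) :
  open U = twin_open U.
Proof. by []. Qed.

Lemma twin_pi_base {I : Type} (g : I -> nat -> nat) :
  pi_base (range (fun i : I => [set ((i, true) : twin g)])).
Proof.
split=> [_ [i _ <-]|U]; first by rewrite twin_openE; split; [move=> j|exists (i, true)].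
rewrite twin_openE => oU [[i []] Ui]; first by exists [set ((i, true) : twin g)]; [exists i|move=> _ ->].
exists [set ((i, true) : twin g)]; first by exists i.
by have [n nU] := oU _ Ui; move=> _ ->; apply: nU; rewrite /cylinder /= size_mkseq.
Qed.

Lemma twin_weakly_lindelof {I : Type} (g : I -> nat -> nat) : weakly_lindelof (twin g).
Proof.
move=> U [oU Ucov].
pose small s := exists2 A, U A & cylinder s `<=` A.
have /choice[W hW] s : exists A, small s -> U A /\ @cylinder _ g s `<=` A.
  by have [[A]|] := pselect (small s); [exists A|exists set0].
exists (W @` small); split.
- by move=> _ [s /hW[? _] <-].
- exact: (card_le_trans (card_image_le _ _) (countableP _)).
- move=> O [[i b] Oib] _; exists (i, b); split=> //.
  have [A UA Ai] : (\bigcup_(A in U) A) ((i, false) : twin g) by rewrite Ucov.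
  have [n nA] := oU _ UA _ Ai.
  have sm : small (mkseq (g i) n) by exists A.
  exists (W (mkseq (g i) n)); first by exists (mkseq (g i) n).
  by have [_] := hW _ sm; apply; rewrite /cylinder /= size_mkseq.
Qed.

Lemma twin_not_weakly_rothberger {I : Type} (g : I -> nat -> nat) :
  (forall f, exists i, forall n, f n <> g i n) -> ~ weakly_rothberger (twin g).
Proof.
move=> gdiff wR.
pose slice n k : set (twin g) := [set x | g x.1 n = k].
have [n|A hA dA] := wR (fun n => range (slice n)).
  split; last first.
    by apply/seteqP; split=> // x _; exists (slice n (g x.1 n)) => //; exists (g x.1 n).
  move=> _ [k _ <-]; rewrite twin_openE => i /= gk; exists n.+1 => x; rewrite /cylinder /mkset size_mkseq.
  move=> /(congr1 (fun s => nth 0%N s n)).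
  by rewrite !nth_mkseq// => e; rewrite /slice /= e.
have /choice[f hf] n : exists k, slice n k = A n by have [k _ <-] := hA n; exists k.
have [i gi] := gdiff f.
have [x [/= -> [n _]]] : [set ((i, true) : twin g)] `&` \bigcup_n A n !=set0.
  by apply: dA; [exists (i, true)|rewrite twin_openE => j].
by rewrite -hf => /esym; exact: gi.
Qed.

Theorem corollary2p13 (R : realType) :
  card_lt (cov_meager R) bounding_number ->
  (exists X : topologicalType,
     [/\ [set: X] !=set0, weakly_lindelof X, ~ weakly_rothberger X
       & pi_weight X #= cov_meager R]) /\
  (forall X : topologicalType,
     [set: X] !=set0 -> weakly_lindelof X -> ~ weakly_rothberger X ->
     cov_meager R #<= pi_weight X).
Proof.
move=> [_ nbcov].
have lower (X : topologicalType) : [set: X] !=set0 -> weakly_lindelof X ->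
    ~ weakly_rothberger X -> cov_meager R #<= pi_weight X.
  move=> X0 wL nwR; apply: meager_cover_le_pi_base => //.
  by have [] := least_cardP _ (pi_base_nonempty X).
split=> //; set M := cov_meager R.
have [[Mmeager Mcov] _] := least_cardP _ (meager_cover_nonempty R).
rewrite -/(cov_meager R) -/M in Mmeager Mcov.
have dom (e : set R -> nat -> nat) :
    exists h, forall A, M A -> eventually_le (e A) h.
  apply: contrapT => nh; apply: nbcov.
  have [_ bmin] := least_cardP _ unbounded_family_nonempty.
  apply: (card_le_trans _ (card_image_le e M)); apply: bmin => -[h hh].
  by apply: nh; exists h => A MA; apply: hh; exists A.
have [g gev] := meager_eventually_different (@Rhausdorff R)
  (real_pi_enumeration R) Mmeager Mcov dom.
have [g' gdiff] := eventually_to_everywhere_different gev.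
pose X : topologicalType := twin (fun A : M => g' (set_val A)).
have X0 : [set: X] !=set0.
  by have [A [/mem_set MA _]] := gdiff id; exists (SigSub MA, true).
have nwR : ~ weakly_rothberger X.
  apply: twin_not_weakly_rothberger => f.
  by have [A [/mem_set MA fA]] := gdiff f; exists (SigSub MA).
exists X; split=> //; first exact: twin_weakly_lindelof.
rewrite card_eq_le lower ?andbT//; last exact: twin_weakly_lindelof.
have [_ pmin] := least_cardP _ (pi_base_nonempty X).
apply: (card_le_trans (pmin _ (@twin_pi_base _ _))).
apply: (card_le_trans (card_image_le _ _)).
by have := card_setT M; rewrite card_eq_le => /andP[].
Qed.
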